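(* Let $X$ be an infinite Hausdorff topological space and let $H=\mathrm{USC}_p^{*}(X)$. Let either $\Phi=\Omega$ and $\tilde\Phi^{\uparrow}=\mathcal D^{\uparrow}$, or $\Phi=\Gamma$ and $\tilde\Phi^{\uparrow}=\mathcal S^{\uparrow}$. Then the following are equivalent: (a) $H$ satisfies the selection principle $\mathrm S_1(\tilde\Phi^{\uparrow}(H),\mathcal D(H))$. (b) $H$ is separable and $X$ has the covering property $\mathrm S_1(\Phi(X),\Omega(X))$. (c) $H$ is separable and satisfies the selection principle $\mathrm S_1(\Phi_h(H),\Omega_h(H))$ for every $h\in H$. (d) $H$ is separable and satisfies the selection principle $\mathrm S_1(\tilde\Phi^{\uparrow}(H),\Omega_h(H))$ for every $h\in H$.
   Context: The set ${}^X\mathbb R$ of all real functions on $X$ carries the product topology (pointwise convergence). $\mathrm{USC}_p^{*}(X)$ is the subspace of all bounded upper semicontinuous functions $f:X\to\mathbb R$ (i.e. $\{x:f(x)<a\}$ is open for every real $a$). Covers: an $\omega$-cover of $X$ is a cover $\mathcal U$ with $X\notin\mathcal U$ such that every finite $F\subseteq X$ is contained in some $U\in\mathcal U$. A $\gamma$-cover is an infinite cover $\mathcal U$ such that for every $x\in X$ the set $\{U\in\mathcal U:x\notin U\}$ is finite. $\Omega(X)$, $\Gamma(X)$ are the families of all open $\omega$-covers and of all open $\gamma$-covers. $\mathrm S_1(\mathcal A,\mathcal B)$, for families $\mathcal A,\mathcal B$ of subsets of a set: for every sequence $\langle A_n:n\in\omega\rangle$ of elements of $\mathcal A$ there are $a_n\in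 A_n$ ($n\in\omega$) with $\{a_n:n\in\omega\}\in\mathcal B$. For $h\in{}^X\mathbb R$ and a family $F$ of real functions on $X$: $F$ has property $(\Omega_h)$ if $h\notin F$ and $h\in\overline F$ in ${}^X\mathbb R$; $F$ has property $(\Gamma_h)$ if $F$ is infinite and for every $\varepsilon>0$ and $x\in X$ the set $\{f\in F:|f(x)-h(x)|\ge\varepsilon\}$ is finite. For $H\subseteq{}^X\mathbb R$, $\Phi_h(H)$ is the set of all $F\subseteq H$ having property $(\Phi_h)$ and such that $f\ge h$ and $f-h\in H$ for every $f\in F$. For $F\subseteq H\subseteq{}^X\mathbb R$: $\mathcal D(H)$ is the set of all $F\subseteq H$ dense in $H$. $F$ is upper sequentially dense in $H$ if for every $f\in H$ there is a sequence $\langle h_n:n\in\omega\rangle$ of elements of $F$ with $h_n\to f$ pointwise, $h_n\ge f$ and $h_n-f\in H$ for all $n$. $F$ is upper dense in $H$ if for every $f\in H$ the set $\{h\in F:h\ge f\wedge h-f\in H\}$ is dense in $\{h\in H:h\ge f\}$. $\mathcal S^{\uparrow}(H)$, $\mathcal D^{\uparrow}(H)$ are the sets of all upper sequentially dense, resp. upper dense, subsets of $H$. *)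

(* Defs.v *)
From HB Require Import structures.
From mathcomp Require Import all_boot all_order all_algebra.
From mathcomp Require Import all_classical all_reals all_analysis.
Set Implicit Arguments.
Unset Strict Implicit.
Unset Printing Implicit Defensive.
Import Order.TTheory GRing.Theory Num.Theory.
Import numFieldNormedType.Exports.
Local Open Scope classical_set_scope.
Local Open Scope ring_scope.

Definition selS1 (T : Type) (A B : set (set T)) : Prop :=
  forall E : nat -> set T, (forall n, A (E n)) ->
    exists e : nat -> T, (forall n, E n (e n)) /\ B (range e).

(* A common index for the two cases of symbols such as Phi(X) and Phi_h(H). *)
Inductive cover_kind := Omega | Gamma.

Section Covers.
Variable X : topologicalType.
Implicit Type U : set (set X).

Definition is_cover U := \bigcup_(V in U) V = [set: X].

Definition omega_cover U :=
  [/\ is_cover U, ~ U [set: X] &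
      forall F : set X, finite_set F -> exists2 V, U V & F `<=` V].

Definition gamma_cover U :=
  [/\ is_cover U, infinite_set U &
      forall x, finite_set [set V | U V /\ ~ V x]].

Definition open_covers (k : cover_kind) : set (set (set X)) :=
  [set U | U `<=` open /\
     match k with Omega => omega_cover U | Gamma => gamma_cover U end].

End Covers.
Arguments open_covers : clear implicits.

Section RealFunctions.
Variables (X : Type) (R : realType).
Implicit Types (f g h : X -> R) (F H : set (X -> R)).

Definition fge f h := forall x, h x <= f x.

(* Closure in the product topology, since X -> R carries no default one. *)
Definition ptws_closure F : set (X -> R) := closure (F : set {ptws X -> R}).

Definition dense_in H F := F `<=` H /\ H `<=` ptws_closure F.

Definition separable H := exists2 D, countable D & dense_in H D.

Definition has_Omega h F := ~ F h /\ ptws_closure F h.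

Definition has_Gamma h F :=
  infinite_set F /\
  forall (e : R) (x : X), 0 < e -> finite_set [set f | F f /\ e <= `|f x - h x|].

Definition converging_families (k : cover_kind) h H : set (set (X -> R)) :=
  [set F | [/\ F `<=` H,
     match k with Omega => has_Omega h F | Gamma => has_Gamma h F end &
     forall f, F f -> fge f h /\ H (f \- h)]].

Definition dense_sets H : set (set (X -> R)) := [set F | dense_in H F].

Definition upper_seq_dense H F :=
  F `<=` H /\
  forall f, H f -> exists u : nat -> X -> R,
    [/\ forall n, F (u n),
        forall x, u n x @[n --> \oo] --> f x &
        forall n, fge (u n) f /\ H (u n \- f)].

Definition upper_dense H F :=
  F `<=` H /\
  forall f, H f ->
    dense_in [set h | H h /\ fge h f] [set h | [/\ F h, fge h f & H (h \- f)]].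

(* D^up(H) for Omega, S^up(H) for Gamma. *)
Definition upper_dense_sets (k : cover_kind) H : set (set (X -> R)) :=
  [set F | match k with
           | Omega => upper_dense H F
           | Gamma => upper_seq_dense H F
           end].

End RealFunctions.

Definition USCb (X : topologicalType) (R : realType) : set (X -> R) :=
  [set f : X -> R | bounded_fun f /\ forall a : R, open [set x | f x < a]].
Arguments USCb : clear implicits.

(* Main.v *)
Require Import Defs.
From mathcomp Require Import all_boot all_order all_algebra.
From mathcomp Require Import all_classical all_reals all_analysis.
From mathcomp Require Import lra.
From Stdlib Require Cantor.

(* The covering properties and the function-space properties are matched by two
   constructions. A cover U of X gives the set of functions g in H that are at
   least 1 off some V in U; it is upper dense because f + C 1_(X \ V) is upper
   semicontinuous for every open V, and functions selected from such sets that
   come close to 0 on a finite set A come from a V containing A. Conversely, a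
   family E converging to h from above gives the open sets {f - h < e} for f
   in E; since such a set may be all of X, one point is removed from it, which
   preserves the covering property because X is infinite and T1. Finally,
   density in H is obtained from a countable dense set by splitting the
   sequence of upper dense sets into countably many subsequences, one for each
   dense function. *)

Import Order.TTheory GRing.Theory Num.Theory.
Import numFieldNormedType.Exports.

Local Open Scope classical_set_scope.
Local Open Scope ring_scope.

(** * Finite and infinite sets along filters and sequences *)

Section InfiniteSets.
Context {T : Type}.
Implicit Types A : set T.

Lemma filter_forall_finite {I : Type} (F : set_system I) A (P : T -> set I) :
  Filter F -> finite_set A -> (forall x, A x -> F (P x)) ->
  F [set i | forall x, A x -> P x i].
Proof.
move=> FF; elim/Pchoice: T => T' in A P *.
by move=> /finite_fsetP[D ->]; exact: filter_bigI.
Qed.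

Lemma infinite_set_seq A : infinite_set A ->
  exists2 u : nat -> T, injective u & forall n, A (u n).
Proof.
move=> /infiniteP; elim/Ppointed: T => T' in A *.
  by rewrite !emptyE => /(congr1 (@^~ 0%N))/=; rewrite propeqE => -[].
move=> /pcard_leP[f]; exists f => [m n fmn|n]; last exact: funS.
by apply: (@inj _ _ setT f) => //; rewrite inE.
Qed.

Lemma inj_seq_near_notin (u : nat -> T) A : injective u -> finite_set A ->
  \forall n \near \oo, ~ A (u n).
Proof.
move=> uI fA.
have : \forall n \near \oo, forall x, A x -> u n <> x.
  apply: filter_forall_finite => // x _.
  have [[m um]|nu] := pselect (exists m, u m = x).
    exists m.+1 => // n /= mn unx; move: mn.
    by rewrite (uI n m) ?ltnn// um.
  by near=> n => unx; apply: nu; exists n.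
by apply: filterS => n un An; exact: un An _.
Unshelve. all: by end_near. Qed.

End InfiniteSets.

(** * Omega-covers and gamma-covers as sequences *)

Section Covers.
Variable X : topologicalType.
Implicit Types (U : set (set X)) (W : nat -> set X).

Lemma is_cover_finite U :
  (forall A, finite_set A -> exists2 V, U V & A `<=` V) -> is_cover U.
Proof.
move=> UP; apply/seteqP; split => // x _.
by have [V UV xV] := UP _ (finite_set1 x); exists V => //; exact: xV.
Qed.

(* Points [y m] off [W m] for [m < N], added to [A], exclude the first [N]
   members. *)
Lemma omega_cover_range_tail W : omega_cover (range W) ->
  forall (N : nat) (A : set X), finite_set A ->
  exists2 n, (N <= n)%N & A `<=` W n.
Proof.
move=> [_ nT WP] N A fA.
have /choice[y yW] n : exists y, ~ W n y.
  apply: contrapT => nex; apply: nT; exists n => //.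
  apply/seteqP; split => // x _; apply: contrapT => nWx.
  by apply: nex; exists x.
have [|_ [n _ <-] sub] := WP (A `|` y @` `I_N).
  by rewrite finite_setU; split => //; exact: finite_image.
exists n => [|x Ax]; last by apply: sub; left.
rewrite leqNgt; apply/negP => nN; apply: (yW n).
by apply: sub; right; exists n.
Qed.

(** Pick a point missed by each member. Were the range finite, these points would form a finite set,
    contained in [W N] for large [N], although [W N] misses its own point. *)
Lemma gamma_cover_range W : X -> (forall n, W n <> setT) ->
  (forall x, \forall n \near \oo, W n x) -> gamma_cover (range W).
Proof.
move=> x0 WnT WP; split.
- apply/seteqP; split => // x _; have [N _ WN] := WP x.
  by exists (W N); [exists N | exact: (WN _ (leqnn N))].
(* [x0] is only a default value for [V = setT]. *)
- have /choice[y yP] (V : set X) : exists y, V <> setT -> ~ V y.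
    have [->|VnT] := pselect (V = setT); first by exists x0.
    have [[y nVy]|nex] := pselect (exists y, ~ V y); first by exists y.
    exfalso; apply: VnT; apply/seteqP; split => // x _; apply: contrapT => nVx.
    by apply: nex; exists x.
  move=> fW.
  have : \forall n \near \oo, forall x, (y @` range W) x -> W n x.
    by apply: filter_forall_finite => [|x _]; [exact: finite_image|exact: WP].
  move=> [N _ /(_ N)] /(_ (leqnn N)).
  move=> WNy; have {}WNy := WNy (y (W N)); apply: (yP (W N)) => //; apply: WNy.
  by exists (W N) => //; exists N.
- move=> x; have [N _ WN] := WP x.
  apply: (@sub_finite_set _ _ (W @` `I_N)); last exact: finite_image.
  move=> _ [[n _ <-] nWx]; exists n => //=.
  by rewrite ltnNge; apply/negP => Nn; apply: nWx; exact: WN.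
Qed.

(** Unlike an omega-cover, a gamma-cover may contain [X]; dropping it leaves an infinite set. Along
    an injective sequence, the finitely many members missing [x] occur only finitely often. *)
Lemma gamma_cover_seq U : gamma_cover U ->
  exists2 W : nat -> set X, forall n, U (W n) /\ W n <> setT &
    forall x, \forall n \near \oo, W n x.
Proof.
move=> [_ infU finU].
have [|W WI WU] := @infinite_set_seq _ (U `\` [set setT]).
  by apply: infinite_setD => //; exact: finite_set1.
exists W => [n|x]; first by have [UW WT] := WU n.
have := inj_seq_near_notin W _ WI (finU x).
apply: filterS => n nW; apply: contrapT => nWx; apply: nW.
by split=> //; have [] := WU n.
Qed.

End Covers.

(** * Closure in the topology of pointwise convergence *)

Section PointwiseClosure.
Variables (R : realType) (X : topologicalType).
Implicit Types (F : set (X -> R)) (h : X -> R).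

Lemma ptws_closureP F h : ptws_closure F h <->
  forall (A : set X) (e : R), finite_set A -> 0 < e ->
    exists2 f, F f & forall x, A x -> `|f x - h x| < e.
Proof.
split=> [Fh A e finA e0|Fh].
  pose B := [set f : X -> R | forall x, A x -> `|f x - h x| < e].
  suff Bh : nbhs (h : {ptws X -> R}) B by have [f [Ff Bf]] := Fh _ Bh; exists f.
  have nbhsh : Filter _ := nbhs_filter (h : {ptws X -> R}).
  apply: (filter_forall_finite _ _ _ nbhsh finA) => x _.
  have := @proj_continuous X (fun=> R) x h (ball (h x) e) (nbhsx_ballx _ _ e0).
  apply: (@filterS _ _ nbhsh) => f.
  by rewrite /= -ball_normE /= distrC.
(* The sets [B (A, e)] generate a filter converging pointwise to [h], so every neighbourhood of [h]
   contains one of them. *)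
pose D := [set Ae : set X * R | finite_set Ae.1 /\ 0 < Ae.2].
pose B (Ae : set X * R) :=
  [set f : X -> R | forall x, Ae.1 x -> `|f x - h x| < Ae.2].
have FF : Filter (filter_from D B).
  apply: filter_from_filter; first by exists (set0, 1); split=> /=.
  move=> [A e] [A' e'] [/= fA e0] [/= fA' e0'].
  exists (A `|` A', Num.min e e').
    by split=> /=; rewrite ?finite_setU ?lt_min ?e0.
  move=> f Bf; split=> x /= Ax; have := Bf x; rewrite /= lt_min.
    by move=> /(_ (or_introl Ax)) /andP[].
  by move=> /(_ (or_intror Ax)) /andP[].
have cvgB : {ptws, filter_from D B --> h}.
  apply/pointwise_cvgP => x; apply/cvgrPdist_lt => e e0.
  exists ([set x], e); first by split => //=; exact: finite_set1.
  by move=> f /(_ x erefl); rewrite /= distrC.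
move=> N /cvgB[[A e] [/= fA e0] BN].
by have [f Ff fh] := Fh A e fA e0; exists f; split=> //; apply: BN.
Qed.

End PointwiseClosure.

(** * Bounded upper semicontinuous functions *)

Section USC.
Context {R : realType} {X : topologicalType}.
Implicit Types f g h : X -> R.

Lemma USCb_bound f : USCb X R f ->
  exists2 M : R, 0 <= M & forall x, `|f x| <= M.
Proof.
move=> [[M [_ fM]] _]; exists (Num.max (M + 1) 0).
  by rewrite le_max lexx orbT.
by move=> x; apply: fM => //; rewrite lt_max ltrDl ltr01.
Qed.

Lemma USCbI f (M : R) : (forall x, `|f x| <= M) ->
  (forall a, open [set x | f x < a]) -> USCb X R f.
Proof.
move=> fM usc; split => //; exists M; split; first exact: num_real.
by move=> N /ltW MN x _; exact: le_trans MN.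
Qed.

Lemma USCb_cst (c : R) : USCb X R (cst c).
Proof.
apply: (USCbI _ `|c|) => // a; have [ca|ac] := boolP (c < a).
  by rewrite [X in open X](_ : _ = setT); [exact: openT | apply/seteqP].
rewrite [X in open X](_ : _ = set0); first exact: open0.
by apply/seteqP; split=> // x /=; rewrite (negbTE ac).
Qed.

Lemma USCbD f g : USCb X R f -> USCb X R g -> USCb X R (f \+ g).
Proof.
move=> Hf Hg.
have [M _ fM] := USCb_bound f Hf; have [N _ gN] := USCb_bound g Hg.
apply: (USCbI _ (M + N)) => [x|a].
  by rewrite (le_trans (ler_normD _ _))// lerD.
rewrite [X in open X](_ : _ =
    \bigcup_(q in [set: R]) ([set x | f x < q] `&` [set x | g x < a - q])).
  apply: bigcup_open => q _; apply: openI; [exact: Hf.2 | exact: Hg.2].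
apply/seteqP; split => [x /= fga|x [q _ []] /=]; last by lra.
(* The witness is the midpoint of [f x] and [a - g x]. *)
by exists (f x + (a - f x - g x) / 2) => //; split => /=; lra.
Qed.

Lemma USCb_nonneg f (M : R) : (forall x, 0 <= f x <= M) ->
  (forall a, 0 < a -> closed [set x | a <= f x]) -> USCb X R f.
Proof.
move=> f0M cl; apply: (USCbI _ M) => [x|a].
  by have /andP[f0 fM] := f0M x; rewrite ger0_norm.
have [a0|a0] := ltP 0 a.
  rewrite [X in open X](_ : _ = ~` [set x | a <= f x]).
    exact/closed_openC/cl.
  by apply/seteqP; split => x /=; rewrite ltNge => /negP.
rewrite [X in open X](_ : _ = set0); first exact: open0.
apply/seteqP; split=> // x /=; have /andP[f0 _] := f0M x.
by rewrite ltNge (le_trans a0 f0).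
Qed.

Lemma USCb_indicC (U : set X) (c : R) : open U -> 0 <= c ->
  USCb X R (fun x => if x \in U then 0 else c).
Proof.
move=> oU c0; apply: (USCb_nonneg _ c) => [x|a a0].
  by case: ifP; rewrite lexx c0.
have [ac|ca] := leP a c.
  rewrite [X in closed X](_ : _ = ~` U); first exact: open_closedC.
  apply/seteqP; split => x /=; case: ifPn; rewrite ?inE ?notin_setE => //.
  by move=> _; rewrite leNgt a0.
rewrite [X in closed X](_ : _ = set0); first exact: closed0.
by apply/seteqP; split=> // x /=; case: ifP => _; lra.
Qed.

(** Superlevel sets at positive heights lie in [A], so they are finite, hence closed in a T1 space
    whatever [d] is. *)
Lemma USCb_finite_support (A : set X) (d : X -> R) (M : R) :
  accessible_space X -> finite_set A -> (forall x, 0 <= d x <= M) ->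
  USCb X R (fun x => if x \in A then d x else 0).
Proof.
move=> T1 fA d0M; apply: (USCb_nonneg _ M) => [x|a a0].
  have /andP[d0 dM] := d0M x; case: ifP => _; first exact/andP.
  by rewrite lexx (le_trans d0).
apply: (accessible_finite_set_closed.1 T1); apply: sub_finite_set fA => x /=.
by case: ifPn => [/[!inE]//|_]; rewrite leNgt a0.
Qed.

End USC.

(** * Selection principles for [H] and for covers *)

Section Selection.
Variables (R : realType) (X : topologicalType).
Hypothesis X_infinite : infinite_set [set: X].
Hypothesis X_T1 : accessible_space X.
Local Notation H := (USCb X R).
Implicit Types (f g h : X -> R) (F E : set (X -> R)) (U : set (set X)).

Let infinite_setC_finite (A : set X) : finite_set A -> exists x, ~ A x.
Proof.
move=> /(infinite_setD X_infinite) /infinite_setN0[x [_ nAx]].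
by exists x.
Qed.

Let open_setD1 (V : set X) x : open V -> open (V `\` [set x]).
Proof.
move=> oV; apply: openI => //; apply: closed_openC.
exact: accessible_closed_set1.
Qed.

Let USCb_sublevel f h (e : R) : H (f \- h) -> open [set x | f x - h x < e].
Proof. by move=> [_]; exact. Qed.

Lemma has_Gamma_seq h F : has_Gamma h F ->
  exists2 u : nat -> X -> R, forall n, F (u n) /\ u n <> h &
    forall x, u n x @[n --> \oo] --> h x.
Proof.
move=> [infF finF].
have [|u uI uF] := @infinite_set_seq _ (F `\` [set h]).
  by apply: infinite_setD => //; exact: finite_set1.
exists u => [n|x]; first by have [] := uF n.
apply/cvgrPdist_lt => e e0.
have := inj_seq_near_notin u _ uI (finF e x e0).
apply: filterS => n nu; rewrite ltNge; apply/negP => eu; apply: nu.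
by split; [have [] := uF n | rewrite distrC].
Qed.

(** Each value [u m] differs from [h] at some point, so convergence there keeps the sequence
    eventually away from [u m]. A finite range would thus be avoided altogether from some index
    on. *)
Lemma cvg_has_Gamma h (u : nat -> X -> R) : (forall n, u n <> h) ->
  (forall x, u n x @[n --> \oo] --> h x) -> has_Gamma h (range u).
Proof.
move=> unh uh; split=> [fu|e x e0].
  have : \forall n \near \oo, forall f, range u f -> u n <> f.
    apply: filter_forall_finite => // _ [m _ <-].
    have [x umx] : exists x, u m x <> h x.
      apply: contrapT => nex; apply: (unh m); apply/funext => x.
      by apply: contrapT => ne; apply: nex; exists x.
    have umx0 : 0 < `|u m x - h x| by rewrite normr_gt0 subr_eq0; exact/eqP.
    have /cvgrPdist_lt/(_ _ umx0) := uh x.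
    by apply: filterS => n + unm; rewrite unm distrC ltxx.
  by move=> [N _ /(_ N (leqnn N))/(_ (u N))]; apply => //; exists N.
have /cvgrPdist_lt/(_ _ e0)[N _ uN] := uh x.
apply: (@sub_finite_set _ _ (u @` `I_N)); last exact: finite_image.
move=> _ [[n _ <-] eu]; exists n => //=; rewrite ltnNge; apply/negP => Nn.
by have := uN n Nn; rewrite /= distrC ltNge eu.
Qed.

(** * From dense selections to covers *)

Definition ge1_off U : set (X -> R) :=
  [set g | H g /\ exists2 V, U V & forall x, ~ V x -> 1 <= g x].

(** When [A] lies in [V], the sum of [f] and this function is [g] on [A], [f] on the rest of [V],
    and [f + M + 1] off [V], which is at least 1 if [M] bounds [|f|]. *)
Let lift f g (V : set X) (A : set X) (M : R) x : R :=
  (if x \in V then 0 else M + 1) + (if x \in A then g x - f x else 0).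

(** The function [f + lift] agrees with [g] on the prescribed finite set. The hypothesis on [U] also
    admits the family [{X}], for which [ge1_off] is all of [H]. *)
Lemma upper_dense_ge1_off U : U `<=` open ->
  (forall A, finite_set A -> exists2 V, U V & A `<=` V) ->
  upper_dense H (ge1_off U).
Proof.
move=> oU UA; split=> [g []//|f Hf]; split=> [g [[Hg _]]//|g [Hg gf]].
apply/ptws_closureP => A e fA e0.
have [V UV AV] := UA _ fA.
have [M M0 fM] := USCb_bound f Hf; have [N N0 gN] := USCb_bound g Hg.
have Hl : H (lift f g V A M).
  apply: USCbD; first by apply: USCb_indicC; [exact: oU | lra].
  apply: (USCb_finite_support _ (fun x => g x - f x) (N + M)) => // x.
  rewrite subr_ge0 gf /=.
  have := fM x; have := gN x.
  by rewrite !ler_norml => /andP[_ ?] /andP[? _]; lra.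
have l0 x : 0 <= lift f g V A M x.
  rewrite /lift addr_ge0//; case: ifP => // _; last by rewrite subr_ge0 gf.
  by rewrite addr_ge0.
have Hfl := USCbD _ _ Hf Hl.
have flB : (f \+ lift f g V A M) \- f = lift f g V A M.
  by apply/funext => x /=; rewrite addrAC subrr add0r.
exists (f \+ lift f g V A M) => [|x Ax]; last first.
  rewrite /= /lift !mem_set//; last exact: AV.
  by rewrite add0r [f x + _]addrC subrK subrr normr0.
split; last 1 first.
- by rewrite flB.
- split=> //; exists V => // x nVx /=.
  have := fM x; rewrite ler_norml => /andP[Mf _].
  have : 0 <= (if x \in A then g x - f x else 0).
    by case: ifP => // _; rewrite subr_ge0 gf.
  by rewrite /lift (memNset nVx); lra.
- by move=> x /=; rewrite lerDl.
Qed.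

(** Adding [M + 1] off [W n] changes [f] at a given point only for finitely many [n]. *)
Lemma upper_seq_dense_ge1_off U (W : nat -> set X) : U `<=` open ->
  (forall n, U (W n)) -> (forall x, \forall n \near \oo, W n x) ->
  upper_seq_dense H (ge1_off U).
Proof.
move=> oU UW WP; split=> [g []//|f Hf].
have [M M0 fM] := USCb_bound f Hf.
pose c n x := if x \in W n then 0 else M + 1.
have Hc n : H (c n) by apply: USCb_indicC; [exact/oU | lra].
exists (fun n => f \+ c n); split=> [n|x|n].
- split; first exact: USCbD.
  exists (W n) => // x nWx; have := fM x; rewrite ler_norml => /andP[Mf _].
  by rewrite /= /c memNset//; lra.
- apply/cvgrPdist_lt => e e0; apply: filterS (WP x) => n Wnx.
  by rewrite /= /c mem_set// addr0 subrr normr0.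
- split=> [x|]; first by rewrite /= lerDl /c; case: ifP => // _; lra.
  rewrite (_ : _ \- _ = c n)//.
  by apply/funext => x /=; rewrite addrAC subrr add0r.
Qed.

Lemma upper_dense_sets_USCb k : upper_dense_sets k H H.
Proof.
rewrite -[X in upper_dense_sets k H X](_ : ge1_off [set setT] = H); last first.
  apply/seteqP; split=> [g []//|g Hg]; split=> //.
  by exists setT => // x /(_ I).
have oT : [set [set: X]] `<=` open by move=> _ ->; exact: openT.
case: k; first by apply: upper_dense_ge1_off => // A _; exists setT.
apply: (upper_seq_dense_ge1_off _ (fun=> setT)) => // x.
exact: filterT.
Qed.

(** [X] is removed because it would impose no condition in [ge1_off], and the sets selected later
    must be proper to form an omega-cover. *)
Lemma upper_dense_sets_cover k U : open_covers X k U ->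
  upper_dense_sets k H (ge1_off (U `\` [set setT])).
Proof.
case: k => -[oU cU].
  have [_ UT UA] := cU.
  apply: upper_dense_ge1_off => [V [/oU]//|A /UA[V UV AV]].
  by exists V => //; split=> // VT; apply: UT; rewrite -VT.
have [W UW Wx] := gamma_cover_seq _ _ cU.
by apply: (upper_seq_dense_ge1_off _ W) => // V [/oU].
Qed.

Theorem sel_dense_sel_covers k : selS1 (upper_dense_sets k H) (dense_sets H) ->
  separable H /\ selS1 (open_covers X k) (open_covers X Omega).
Proof.
move=> sel; split.
  (* Selecting from the constant sequence [H] yields a countable dense set. *)
  have [n|e [_ de]] := sel (fun=> H); first exact: upper_dense_sets_USCb.
  by exists (range e) => //; exact: card_image_le.
move=> U cU.
have [n|e [eE [_ de]]] := sel (fun n => ge1_off (U n `\` [set setT])).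
  exact: upper_dense_sets_cover.
have /choice[V VP] n : exists V, [/\ U n V, V <> setT &
    forall x, ~ V x -> 1 <= e n x].
  by have [_ [V [UV VT]]] := eE n; exists V.
have cV A : finite_set A -> exists2 B, range V B & A `<=` B.
  (* A selected function within 1 of the zero function on [A] is below 1 there, so [A] lies in its
     set [V n]. *)
  move=> fA; have /ptws_closureP/(_ A 1 fA ltr01) := de _ (USCb_cst 0).
  move=> [_ [n _ <-]] enA; exists (V n); first by exists n.
  move=> x Ax; apply: contrapT => nVx; have [_ _ /(_ x nVx)] := VP n.
  have := enA x Ax; rewrite /= subr0 ltr_norml => /andP[_].
  by rewrite ltNge => /negbTE ->.
exists V; split=> [n|]; first by have [] := VP n.
split=> [_ [n _ <-]|].
  by have [Un _ _] := VP n; have [oU _] := cU n; exact: oU.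
split=> //; first exact: is_cover_finite.
by move=> [n _ VT]; have [_ /(_ VT)] := VP n.
Qed.

(** * From covers to converging families *)

Lemma converging_family_cover k h E (e : R) : 0 < e ->
  converging_families k h H E ->
  exists2 U, open_covers X k U & forall V, U V -> exists f,
    [/\ E f, f <> h & forall x, V x -> `|f x - h x| < e].
Proof.
move=> e0 [_ Eh Efh].
pose S f : set X := [set x | f x - h x < e].
have SP f : E f -> open (S f) /\ forall x, S f x -> `|f x - h x| < e.
  move=> /Efh[fh Hfh]; split; first exact: USCb_sublevel.
  by move=> x Sx; rewrite ger0_norm// subr_ge0 fh.
have SD1T f x : S f `\` [set x] <> setT.
  move=> ST; have [_ nxx] : (S f `\` [set x]) x by rewrite ST.
  exact: nxx.
case: k Eh => [[nEh clh]|/has_Gamma_seq[u uE uh]].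
  (* All choices of the removed point are allowed, so that one outside a given finite set is
     available. *)
  exists [set V | exists f x, E f /\ V = S f `\` [set x]]; last first.
    move=> _ [f [x [Ef ->]]]; exists f; split=> // [fh|y [Sy _]].
      by apply: nEh; rewrite -fh.
    by have [_] := SP f Ef; apply.
  split=> [_ [f [x [Ef ->]]]|].
    by apply: open_setD1; have [] := SP f Ef.
  have cU A : finite_set A -> exists2 V : set X,
      (exists f x, E f /\ V = S f `\` [set x]) & A `<=` V.
    move=> fA; have [x nAx] := infinite_setC_finite A fA.
    have [f Ef fA'] := (ptws_closureP _ _ E h).1 clh A e fA e0.
    exists (S f `\` [set x]); first by exists f, x.
    move=> y Ay; split=> [|yx]; last by apply: nAx; rewrite -yx.
    exact: le_lt_trans (ler_norm _) (fA' y Ay).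
  split=> //; first exact: is_cover_finite.
  by move=> [f [x [_ /esym/SD1T]]].
(* The removed points [p n] are distinct, so each point of [X] is removed at most once. *)
have [p pI _] := infinite_set_seq _ X_infinite.
exists (range (fun n => S (u n) `\` [set p n])); last first.
  move=> _ [n _ <-]; have [Eun unh] := uE n; exists (u n); split=> // x [Sx _].
  by have [_] := SP _ Eun; apply.
split=> [_ [n _ <-]|].
  by apply: open_setD1; have [/SP[]] := uE n.
apply: gamma_cover_range => [|n|x]; [exact: p 0%N | exact: SD1T |].
have /cvgrPdist_lt/(_ e e0) ux := uh x.
have px := inj_seq_near_notin p _ pI (finite_set1 x).
apply: filterS2 ux px => n ux px; split=> [|xp]; last exact/px.
by rewrite /S /=; apply: le_lt_trans ux; rewrite distrC ler_norm.
Qed.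

(** The [n]-th cover uses precision [1/(n+1)]. A finite set lies in selected members of arbitrarily
    large index, which makes the error there as small as desired. *)
Theorem sel_covers_sel_converging k h :
  selS1 (open_covers X k) (open_covers X Omega) ->
  selS1 (converging_families k h H) (converging_families Omega h H).
Proof.
move=> sel E cE.
have /choice[U UP] n : exists U, open_covers X k U /\
    forall V, U V -> exists f,
      [/\ E n f, f <> h & forall x, V x -> `|f x - h x| < n.+1%:R^-1].
  have [|U ? ?] := @converging_family_cover k h (E n) n.+1%:R^-1 _ (cE n).
    by rewrite invr_gt0 ltr0n.
  by exists U.
have [n|V [UV [_ cV]]] := sel U; first by have [] := UP n.
have /choice[f fP] n := (UP n).2 _ (UV n).
exists f; split=> [n|]; first by have [] := fP n.
split=> [_ [n _ <-]||_ [n _ <-]].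
- by have [Ef _ _] := fP n; have [EH _ _] := cE n; exact: EH.
- split=> [[n _ fh]|]; first by have [] := fP n.
  apply/ptws_closureP => A e fA e0.
  have [N _ Ne] := near_infty_natSinv_lt (PosNum e0).
  have [n Nn AV] := omega_cover_range_tail _ _ cV N A fA.
  exists (f n); first by exists n.
  move=> x Ax; have [_ _ /(_ x (AV x Ax))] := fP n.
  by move=> /lt_trans; apply; exact: Ne.
- by have [Ef _ _] := fP n; have [_ _ Eh] := cE n; exact: Eh.
Qed.

(** * Upper dense sets, density and converging families *)

Theorem sel_upper_dense_sel_dense k : separable H ->
  (forall h, H h ->
    selS1 (upper_dense_sets k H) (converging_families Omega h H)) ->
  selS1 (upper_dense_sets k H) (dense_sets H).
Proof.
move=> [D cD [DH dD]] sel E uE.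
(* Either [D] is empty, impossible since the zero function is in its closure, or [d] enumerates
   [D]. *)
have [D0|[d]] := pfcard_geP cD.
  have /ptws_closureP/(_ set0 1 (finite_set0 X) ltr01) := dD _ (USCb_cst 0).
  by rewrite D0 => -[].
have Dd m : D (d m) by exact: funS.
(* The subsequence with indices coding [(m, k)] is devoted to approximating [d m]. *)
have /choice[e eP] m : exists e : nat -> X -> R,
    (forall k, E (Cantor.to_nat (m, k)) (e k)) /\
    converging_families Omega (d m) H (range e).
  by apply: (sel _ (DH _ (Dd m)) (fun k => E (Cantor.to_nat (m, k)))) => j.
exists (fun n => e (Cantor.of_nat n).1 (Cantor.of_nat n).2); split=> [n|].
  have [+ _] := eP (Cantor.of_nat n).1; move=> /(_ (Cantor.of_nat n).2).
  by rewrite -surjective_pairing Cantor.cancel_to_of.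
split=> [_ [n _ <-]|f Hf].
  have [_ [+ _ _]] := eP (Cantor.of_nat n).1.
  by apply; exists (Cantor.of_nat n).2.
apply/ptws_closureP => A r fA r0; have r20 : 0 < r / 2 by lra.
have /ptws_closureP/(_ A _ fA r20)[g Dg gf] := dD _ Hf.
have [m _ dm] : (d @` setT) g by rewrite image_eq.
have [_ [_ [_ /ptws_closureP clm] _]] := eP m.
have [_ [j _ <-] ej] := clm A _ fA r20; exists (e m j).
  by exists (Cantor.to_nat (m, j)) => //; rewrite Cantor.cancel_of_to.
move=> x Ax; have := gf x Ax; have := ej x Ax.
rewrite dm !ltr_norml => /andP[? ?] /andP[? ?].
by apply/andP; split; lra.
Qed.

(* Shrinking [e] below the distances from [h] to the first [N] terms
   excludes them. *)
Lemma ptws_closure_range_tail h (u : nat -> X -> R) :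
  (forall n, u n <> h) -> ptws_closure (range u) h ->
  forall (N : nat) (A : set X) (e : R), finite_set A -> 0 < e ->
  exists2 n, (N <= n)%N & forall x, A x -> `|u n x - h x| < e.
Proof.
move=> unh /ptws_closureP uh N A e fA e0.
have /choice[y yP] n : exists y, u n y <> h y.
  apply: contrapT => nex; apply: (unh n); apply/funext => x.
  by apply: contrapT => ne; apply: nex; exists x.
have : \forall d \near 0^'+, forall n, `I_N n -> d < `|u n (y n) - h (y n)|.
  apply: filter_forall_finite => // n _.
  by apply: nbhs_right_lt; rewrite normr_gt0 subr_eq0; exact/eqP.
move=> dN; have [d [[dP de] d0]] : exists d : R,
    ((forall n, `I_N n -> d < `|u n (y n) - h (y n)|) /\ d < e) /\ 0 < d.
  apply: (@filter_ex _ (nbhs (0 : R)^'+)).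
  apply: filterI; last exact: nbhs_right_gt.
  by apply: filterI; [exact: dN | exact: nbhs_right_lt].
have [|_ [n _ <-] und] := uh (A `|` y @` `I_N) d _ d0.
  by rewrite finite_setU; split => //; exact: finite_image.
exists n; last by move=> x Ax; apply: lt_trans de; apply: und; left.
rewrite leqNgt; apply/negP => nN; have := dP n nN.
by rewrite ltNge ltW//; apply: und; right; exists n.
Qed.

(* For [Gamma] the family consists of the functions [u k - c + 1/(k+1)], where
   [u k] converges to [h + c] from above: aiming above [h] keeps [u k] itself
   different from [h], and the term [1/(k+1)] makes the family infinite. *)
Lemma upper_dense_converging k h E (c : R) : H h -> 0 < c ->
  upper_dense_sets k H E ->
  exists2 F, converging_families k h H F & forall f, F f -> exists g,
    [/\ E g, fge g h, H (g \- h), g <> h & forall x, g x <= f x + c].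
Proof.
move=> Hh c0; have [x0 _] := infinite_setN0 X_infinite.
have addc_neq g : (forall x, h x < g x) -> g <> h.
  by move=> hg gh; have := hg x0; rewrite gh ltxx.
have Hhc : H (h \+ cst c) by apply: USCbD => //; exact: USCb_cst.
case: k => -[EH Eh].
  exists [set f | [/\ E f, fge f h & H (f \- h)] /\ f <> h]; last first.
    by move=> f [[Ef fh Hfh] fnh]; exists f; split=> // x; rewrite lerDl ltW.
  split=> [f [[/EH]]//||f [[]]//].
  split=> [[]//|]; apply/ptws_closureP => A e fA e0.
  have e20 : 0 < e / 2 by lra.
  (* Approximating [h + e/2] within [e/2] keeps [f] within [e] of [h]; doing so at [x0] as well
     forces [f] to differ from [h]. *)
  have Hhe : H (h \+ cst (e / 2)) by apply: USCbD => //; exact: USCb_cst.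
  have geh : fge (h \+ cst (e / 2)) h by move=> x /=; rewrite lerDl ltW.
  have [_ /(_ _ (conj Hhe geh))/ptws_closureP] := Eh h Hh.
  move=> /(_ (A `|` [set x0]) (e / 2)).
  case=> [|//|f [Ef fh Hfh] fA2].
    by rewrite finite_setU; split=> //; exact: finite_set1.
  exists f => [|x Ax]; first split=> // fE.
    have := fA2 x0 (or_intror erefl); rewrite fE /= opprD addrA subrr add0r.
    by rewrite normrN gtr0_norm// ltxx.
  by have := fA2 x (or_introl Ax); rewrite /= !ltr_norml => /andP[? ?];
    have := fh x => ?; apply/andP; split; lra.
have [u [uE ut uhc]] := Eh _ Hhc.
pose e k : R := k.+1%:R^-1.
pose v k := u k \+ cst (e k - c).
have e0 k : 0 < e k by rewrite invr_gt0 ltr0n.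
have hcu k x : h x + c <= u k x by have [+ _] := uhc k; apply.
have hv k x : h x < v k x by have := hcu k x; have := e0 k; rewrite /v /=; lra.
have Huh k d : H ((u k \- (h \+ cst c)) \+ cst d).
  by apply: USCbD; [have [] := uhc k | exact: USCb_cst].
exists (range v); last first.
  move=> _ [k _ <-]; exists (u k); split => //.
  - by move=> x; have := hcu k x; lra.
  - rewrite (_ : _ \- _ = (u k \- (h \+ cst c)) \+ cst c)//.
    by apply/funext => x /=; lra.
  - by apply: addc_neq => x; have := hcu k x; lra.
  - move=> x; have := e0 k; rewrite /v /=. lra.
split=> [_ [k _ <-]||_ [k _ <-]].
- by apply: USCbD; [exact/EH | exact: USCb_cst].
- apply: cvg_has_Gamma => [k|x]; first exact/addc_neq/hv.
  rewrite (_ : h x = (h \+ cst c) x + (0 - c)); last by rewrite /=; lra.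
  apply: cvgD; first exact: ut.
  by apply: cvgB; [exact: cvg_harmonic | exact: cvg_cst].
- split=> [x|]; first exact/ltW/hv.
  rewrite (_ : _ \- _ = (u k \- (h \+ cst c)) \+ cst (e k))//.
  by apply/funext => x; rewrite /v /=; lra.
Qed.

(** Since [h <= g n <= f n + 1/(n+1)], the function [g n] is near [h] wherever [f n] is, provided
    [n] is large. Such [n] exist because [h] is in the closure of the [f n] without being one of
    them. *)
Theorem sel_converging_sel_upper_dense k h : H h ->
  selS1 (converging_families k h H) (converging_families Omega h H) ->
  selS1 (upper_dense_sets k H) (converging_families Omega h H).
Proof.
move=> Hh sel E uE.
have /choice[F FP] n : exists F, converging_families k h H F /\
    forall f, F f -> exists g, [/\ E n g, fge g h, H (g \- h), g <> h &
      forall x, g x <= f x + n.+1%:R^-1].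
  have [|F ? ?] := @upper_dense_converging k h (E n) n.+1%:R^-1 Hh _ (uE n).
    by rewrite invr_gt0 ltr0n.
  by exists F.
have [n|f [Ff [_ [nfh clh] _]]] := sel F; first by have [] := FP n.
have /choice[g gP] n := (FP n).2 _ (Ff n).
exists g; split=> [n|]; first by have [] := gP n.
split=> [_ [n _ <-]||_ [n _ <-]]; last by have [] := gP n.
  have [Eg _ _ _ _] := gP n; have := uE n.
  by case: (k) => -[EH _]; exact: EH.
split=> [[n _ gh]|]; first by have [] := gP n.
apply/ptws_closureP => A e fA e0; have e20 : 0 < e / 2 by lra.
have [N _ Ne] := near_infty_natSinv_lt (PosNum e20).
have fnh n : f n <> h by move=> fh; apply: nfh; exists n.
have [n Nn fA2] := ptws_closure_range_tail h f fnh clh N A _ fA e20.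
exists (g n) => [|x Ax]; first by exists n.
have [_ gh _ _ /(_ x) gf] := gP n.
have fhx : f n x - h x < e / 2 := le_lt_trans (ler_norm _) (fA2 x Ax).
have ne : n.+1%:R^-1 < e / 2 := Ne n Nn.
rewrite ger0_norm ?subr_ge0 ?gh//.
by move: gf ne; set d := _^-1 => gf ne; lra.
Qed.

End Selection.

Theorem theorem5p2 (R : realType) (X : topologicalType)
  (X_infinite : infinite_set [set: X]) (X_hausdorff : hausdorff_space X)
  (Phi : cover_kind) :
  let H := USCb X R in
  [<-> selS1 (upper_dense_sets Phi H) (dense_sets H);
       separable H /\ selS1 (open_covers X Phi) (open_covers X Omega);
       separable H /\ forall h, H h ->
         selS1 (converging_families Phi h H) (converging_families Omega h H);
       separable H /\ forall h, H h ->
         selS1 (upper_dense_sets Phi H) (converging_families Omega h H)].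
Proof.
move=> H; have X_T1 := hausdorff_accessible X_hausdorff.
tfae.
- exact: sel_dense_sel_covers.
- by move=> [sepH sel]; split=> // h _; exact: sel_covers_sel_converging.
- move=> [sepH sel]; split=> // h Hh.
  exact: sel_converging_sel_upper_dense (sel h Hh).
- by move=> [sepH sel]; exact: sel_upper_dense_sel_dense.
Qed.
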